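(* Let $\Gamma=(V,E,\ell)$ be a finite labeled simplicial graph with all labels even, $\mathbb{K}$ a field, and $\chi:A_\Gamma\to\mathbb{Z}$ a nonzero homomorphism with Artin kernel $A^\chi_\Gamma=\ker\chi$. Then the rank of the free part of the $\mathbb{K}[t^{\pm1}]$-module $H_1(A^\chi_\Gamma;\mathbb{K})$ equals $\dim_{\mathbb{K}}\tilde H_0(\Gamma_1;\mathbb{K})$. In particular, $H_1(A^\chi_\Gamma;\mathbb{K})$ is a torsion module if and only if $\Gamma_1$ is connected.
   Context: $\Gamma=(V,E,\ell)$: finite simplicial graph, labels $\ell(e)=2\tilde\ell(e)$, $\tilde\ell(e)\ge1$; $A_\Gamma=\langle g_v\ (v\in V)\mid (g_vg_w)^{\tilde\ell(e)}=(g_wg_v)^{\tilde\ell(e)},\ e=\{v,w\}\in E\rangle$. Write $m_v=\chi(g_v)$ and $m_e=m_v+m_w$ for $e=\{v,w\}\in E$. $H_1(A^\chi_\Gamma;\mathbb{K})$ is a $\mathbb{K}[t^{\pm1}]$-module, $t$ acting via the automorphism induced by conjugation by an element $g\in A_\Gamma$ such that $\chi(g)$ generates $\operatorname{im}\chi$. The resonance sets are $V_{\mathcal R}=\{v\in V: m_v=0\}$ and $E_{\mathcal R}=\{e\in E: m_e=0\text{ and }\tilde\ell(e)\cdot1_{\mathbb{K}}=0\}$. The graph $\Gamma_1$ is obtained from $\Gamma$ by deleting the (open) edges $e=\{v,w\}\in E$ for which either $v,w\in V_{\mathcal R}$ or $e\in E_{\mathcal R}$, and deleting (with their incident edges) the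 vertices $v\in V_{\mathcal R}$ that are adjacent in $\Gamma$ to some vertex of $V\setminus V_{\mathcal R}$. $\tilde H_0(\Gamma_1;\mathbb{K})$ is reduced $0$-th homology of $\Gamma_1$ viewed as a $1$-dimensional complex. *)

(* Defs.v *)
From mathcomp Require Import all_boot all_order all_algebra.
Set Implicit Arguments. Unset Strict Implicit. Unset Printing Implicit Defensive.
Import Order.TTheory GRing.Theory Num.Theory.
Local Open Scope ring_scope.

(* (v, false) is the letter g_v, (v, true) is g_v^{-1}. *)
Definition word (V : Type) := seq (V * bool).

Definition winv (V : Type) (w : word V) : word V :=
  rev (map (fun p => (p.1, ~~ p.2)) w).

Definition wpow (V : Type) (w : word V) (n : nat) : word V := flatten (nseq n w).

Definition artin_rel (V : Type) (v w : V) (n : nat) : word V :=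
  wpow [:: (v, false); (w, false)] n.

(* Equality in the even Artin group A_Gamma: the congruence on words generated
   by free cancellation and the relations (g_v g_w)^{lt e} = (g_w g_v)^{lt e}
   for edges e = {v,w}; here lt = \tilde\ell, i.e. the label is 2 * lt. *)
Inductive aeq (V : Type) (adj : rel V) (lt : V -> V -> nat) : word V -> word V -> Prop :=
| aeq_refl u : aeq adj lt u u
| aeq_sym u w : aeq adj lt u w -> aeq adj lt w u
| aeq_trans u w x : aeq adj lt u w -> aeq adj lt w x -> aeq adj lt u x
| aeq_ctx a b u w : aeq adj lt u w -> aeq adj lt (a ++ u ++ b) (a ++ w ++ b)
| aeq_free v b : aeq adj lt [:: (v, b); (v, ~~ b)] [::]
| aeq_artin v w : adj v w ->
    aeq adj lt (artin_rel v w (lt v w)) (artin_rel w v (lt v w)).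

Definition chi (V : Type) (m : V -> int) (w : word V) : int :=
  \sum_(p <- w) (if p.2 then - m p.1 else m p.1).

(* ---------- H_1(A^chi; K) = (A^chi)_ab (x) K ---------- *)
(* Chains: finite formal K-combinations of words (elements of the kernel). *)
Section H1.
Variables (V : eqType) (adj : rel V) (lt : V -> V -> nat) (m : V -> int)
          (K : fieldType).

Definition chain := seq (K * word V).

Definition coef (c : chain) (w : word V) : K := \sum_(p <- c | p.2 == w) p.1.

Definition is_chain (c : chain) : bool := all (fun p => chi m p.2 == 0) c.

(* Generators of the kernel of  K[A^chi] -> H_1(A^chi;K) (K-span):
   [u] + [w] - [uw] for u, w in A^chi, and [u] - [w] for u = w in A_Gamma. *)
Inductive h1rel : chain -> Prop :=
| h1rel_nil : h1rel [::]
| h1rel_mul a u w : chi m u = 0 -> chi m w = 0 ->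
    h1rel [:: (a, u); (a, w); (- a, u ++ w)]
| h1rel_eq a u w : chi m u = 0 -> aeq adj lt u w ->
    h1rel [:: (a, u); (- a, w)]
| h1rel_cat c c' : h1rel c -> h1rel c' -> h1rel (c ++ c').

Definition h1zero (c : chain) : Prop :=
  exists r, h1rel r /\ forall w, coef c w = coef r w.

Definition scalec (a : K) (c : chain) : chain := map (fun p => (a * p.1, p.2)) c.

Definition conjc (h : word V) (k : nat) (c : chain) : chain :=
  map (fun p => (p.1, wpow h k ++ p.2 ++ winv (wpow h k))) c.

(* Laurent polynomial t^{-n} p(t) in K[t^{+-1}] represented as (n, p);
   it is zero iff p = 0. *)
Definition laurent := (nat * {poly K})%type.

(* Action of K[t^{+-1}] where t acts by conjugation by g. *)
Definition lact (g : word V) (l : laurent) (c : chain) : chain :=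
  flatten [seq scalec l.2`_i (conjc g i (conjc (winv g) l.1 c))
          | i <- iota 0 (size l.2)].

Definition h1_independent (g : word V) (cs : seq chain) : Prop :=
  all is_chain cs /\
  forall ls : seq laurent, size ls = size cs ->
    h1zero (flatten [seq lact g lc.1 lc.2 | lc <- zip ls cs]) ->
    all (fun l => l.2 == 0) ls.

Definition h1_rank_is (g : word V) (r : nat) : Prop :=
  (exists cs, h1_independent g cs /\ size cs = r) /\
  (forall cs, h1_independent g cs -> (size cs <= r)%N).

Definition h1_torsion (g : word V) : Prop :=
  forall c, is_chain c -> exists l : laurent, l.2 != 0 /\ h1zero (lact g l c).
End H1.

Section Gamma1.
Variables (V : finType) (adj : rel V) (lt : V -> V -> nat) (m : V -> int)
          (K : fieldType).

Definition VR (v : V) : bool := m v == 0.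
Definition ER (v w : V) : bool := (m v + m w == 0) && ((lt v w)%:R == 0 :> K).

Definition V1 : pred V := fun v => ~~ (VR v && [exists w, adj v w && ~~ VR w]).
Definition E1 : rel V := fun v w =>
  [&& adj v w, V1 v, V1 w, ~~ (VR v && VR w) & ~~ ER v w].

Definition ncomp_Gamma1 : nat := n_comp E1 V1.
End Gamma1.

(* Main.v *)
From HB Require Import structures.
Require Import Defs.
From mathcomp Require Import all_boot all_order all_algebra.
From mathcomp Require Import boolp.
Set Implicit Arguments. Unset Strict Implicit. Unset Printing Implicit Defensive.
Import GRing.Theory Num.Theory.
Local Open Scope ring_scope.
Local Notation "x %:F" := (@FracField.tofrac _ x).

(** Write [F] for the fraction field of [K[t]].  The classes of the words
    [u g^(-deg u)] satisfy the cocycle rule [[u w] = [u] + t^(deg u) [w]], so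
    [H_1] is generated over the Laurent polynomials by the [x_v = [g_v]],
    subject to the Fox relations of the edges and to [[g] = 0].  The edge
    [{v, w}] contributes
    [N ((1 - t^(deg w)) x_v - (1 - t^(deg v)) x_w)] with
    [N = sum_(i < lt) t^(i (deg v + deg w))], and [N = 0] exactly on [E_R].
    Over [F] the solutions of the edge relations therefore form a space with
    one basis vector for each component of [Gamma_1], and the fundamental
    formula of Fox calculus shows that the relation [[g] = 0] cuts the
    dimension by exactly one. *)

(** * Coordinates of module elements over the fraction field *)

Section FractionalCoordinates.
Variable R : idomainType.
Local Notation F := {fraction R}.

Lemma fraction_clear (a : F) : exists d n : R, d != 0 /\ d%:F * a = n%:F.
Proof.
elim/quotW: a => a; exists (\d_a), (\n_a); split; first exact: denom_ratioP.
have d0 := denom_ratioP a.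
rewrite -[_ * _]/(FracField.mul _ _) !piE; apply/eqmodP.
rewrite /= FracField.equivfE !numden_Ratio ?mulf_neq0 ?oner_neq0 //.
by rewrite mul1r mulr1 mulrC.
Qed.

(** The product of the individual denominators serves as a common one. *)
Lemma fraction_clear_fin (I : finType) (a : I -> F) :
  exists (d : R) (n : I -> R), d != 0 /\ forall i, d%:F * a i = (n i)%:F.
Proof.
have [d Hd] := @fin_all_exists _ _ _ (fun i => fraction_clear (a i)).
have [n {}Hd] := fin_all_exists Hd.
exists (\prod_i d i), (fun i => n i * \prod_(j | j != i) d j); split.
  by rewrite prodf_seq_neq0; apply/allP => i _; have [] := Hd i.
move=> i; have [_ Hi] := Hd i.
by rewrite (bigD1 i) //= !rmorphM /= -Hi mulrAC.
Qed.

Variables (M : lmodType R) (n : nat) (x : 'I_n -> M).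

(* [y] equals the combination of the [x i] with coefficients [q] after
   extension of scalars from [R] to its field of fractions. *)
Definition fcoord (y : M) (q : 'rV[F]_n) : Prop :=
  exists (p : R) (q' : 'I_n -> R),
    [/\ p != 0, forall i, p%:F * q 0 i = (q' i)%:F
      & p *: y = \sum_i q' i *: x i].

Lemma fcoord0 : fcoord 0 0.
Proof.
exists 1, (fun=> 0); split; first exact: oner_neq0.
  by move=> i; rewrite mxE mulr0 rmorph0.
by rewrite scaler0 big1 // => i _; rewrite scale0r.
Qed.

Lemma fcoord_gen i : fcoord (x i) (delta_mx 0 i).
Proof.
exists 1, (fun j => (j == i)%:R); split; first exact: oner_neq0.
  by move=> j; rewrite mxE eqxx rmorph_nat rmorph1 mul1r.
rewrite scale1r (bigD1 i) //= eqxx scale1r big1 ?addr0 // => j /negPf ->.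
by rewrite scale0r.
Qed.

Lemma fcoordD y q z r : fcoord y q -> fcoord z r -> fcoord (y + z) (q + r).
Proof.
move=> [p [q' [p0 Hq Hy]]] [s [r' [s0 Hr Hz]]].
exists (p * s), (fun i => s * q' i + p * r' i); split; first exact: mulf_neq0.
  by move=> i; rewrite mxE rmorphD !rmorphM /= -Hq -Hr mulrDr -!mulrA; congr (_ + _);
    rewrite 1?mulrCA.
rewrite scalerDr {1}mulrC -!scalerA Hy Hz !scaler_sumr -big_split /=.
by apply: eq_bigr => i _; rewrite scalerDl !scalerA.
Qed.

Lemma fcoordZ a y q : fcoord y q -> fcoord (a *: y) (a%:F *: q).
Proof.
move=> [p [q' [p0 Hq Hy]]]; exists p, (fun i => a * q' i); split => //.
  by move=> i; rewrite mxE rmorphM /= -Hq mulrCA.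
rewrite scalerA mulrC -scalerA Hy scaler_sumr.
by apply: eq_bigr => i _; rewrite scalerA.
Qed.

Lemma fcoordN y q : fcoord y q -> fcoord (- y) (- q).
Proof. by move/(fcoordZ (-1)); rewrite rmorphN1 !scaleN1r. Qed.

(** Cancelling [a] is sound even when [M] has torsion: the clearing factor [p] absorbs it. *)
Lemma fcoordZK a y q : a != 0 -> fcoord (a *: y) (a%:F *: q) -> fcoord y q.
Proof.
move=> a0 [p [q' [p0 Hq Hy]]]; exists (p * a), q'; split.
- exact: mulf_neq0.
- by move=> i; rewrite -Hq mxE rmorphM /= mulrA.
- by rewrite -scalerA.
Qed.

(** The way back from linear algebra over [F] to the module: the cleared coefficients all vanish,
    and the clearing factor becomes an annihilator. *)
Lemma fcoord_torsion y : fcoord y 0 -> exists2 p : R, p != 0 & p *: y = 0.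
Proof.
move=> [p [q' [p0 Hq Hy]]]; exists p => //.
rewrite Hy big1 // => i _; move: (Hq i); rewrite mxE mulr0 => /esym/eqP.
by rewrite tofrac_eq0 => /eqP ->; rewrite scale0r.
Qed.

(** The relation vectors, those [q] with [fcoord 0 q], thus form a subspace over [F] and not merely
    an [R]-submodule: multiply by the numerator of [a], then cancel its denominator. *)
Lemma fcoord0Z (a : F) q : fcoord 0 q -> fcoord 0 (a *: q).
Proof.
have [d [c [d0 da]]] := fraction_clear a => /(fcoordZ c).
rewrite scaler0 => Hq; apply: (@fcoordZK d) => //.
by rewrite scaler0 scalerA da.
Qed.

Lemma fcoord0_sum (I : finType) (f : I -> 'rV[F]_n) :
  (forall i, fcoord 0 (f i)) -> fcoord 0 (\sum_i f i).
Proof.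
move=> Hf; elim/big_ind: _ => // [|q r]; first exact: fcoord0.
by move/fcoordD => H /H; rewrite addr0.
Qed.

End FractionalCoordinates.

(** * Words, inverses and integer powers modulo the group congruence *)

Section Words.
Variables (V : Type) (adj : rel V) (lt : V -> V -> nat).
Local Notation "u ~ w" := (aeq adj lt u w) (at level 70).

Lemma aeq_cat u u' w w' : u ~ u' -> w ~ w' -> u ++ w ~ u' ++ w'.
Proof.
move=> Hu Hw; apply: (@aeq_trans _ _ _ _ (u' ++ w)).
  exact: (aeq_ctx [::] w Hu).
by have := aeq_ctx u' [::] Hw; rewrite !cats0.
Qed.

Lemma aeq_catl u w w' : w ~ w' -> u ++ w ~ u ++ w'.
Proof. by apply: aeq_cat; apply: aeq_refl. Qed.

Lemma aeq_catr u u' w : u ~ u' -> u ++ w ~ u' ++ w.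
Proof. by move/aeq_cat; apply; apply: aeq_refl. Qed.

Lemma winv_cat (u w : word V) : winv (u ++ w) = winv w ++ winv u.
Proof. by rewrite /winv map_cat rev_cat. Qed.

Lemma winvK (u : word V) : winv (winv u) = u.
Proof.
rewrite /winv map_rev revK -map_comp -[RHS]map_id.
by apply: eq_map => -[v b] /=; rewrite negbK.
Qed.

Lemma aeq_mulwV u : u ++ winv u ~ [::].
Proof.
elim: u => [|[v b] u IH]; first exact: aeq_refl.
rewrite -cat1s winv_cat -catA (catA u).
apply: aeq_trans (aeq_free _ _ v b).
exact: (aeq_catl [:: (v, b)] (aeq_catr _ IH)).
Qed.

Lemma aeq_mulVw u : winv u ++ u ~ [::].
Proof. by have := aeq_mulwV (winv u); rewrite winvK. Qed.

Lemma wpowS (w : word V) n : wpow w n.+1 = w ++ wpow w n.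
Proof. by []. Qed.

Lemma wpowSr (w : word V) n : wpow w n.+1 = wpow w n ++ w.
Proof. by elim: n => [|n IH]; [rewrite /wpow /= cats0 | rewrite wpowS {1}IH catA]. Qed.

Lemma wpowD (w : word V) i j : wpow w (i + j) = wpow w i ++ wpow w j.
Proof. by elim: i => // i IH; rewrite addSn !wpowS IH catA. Qed.

Variable g : word V.

Definition gpow (k : int) : word V :=
  match k with Posz n => wpow g n | Negz n => wpow (winv g) n.+1 end.

Lemma gpow_succ k : g ++ gpow k ~ gpow (k + 1).
Proof.
case: k => [n|n]; first by rewrite -PoszD addn1; apply: aeq_refl.
rewrite /gpow wpowS catA NegzE -addn1 PoszD opprD subrK.
case: n => [|n]; rewrite -?NegzE /=; exact: (aeq_catr _ (aeq_mulwV g)).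
Qed.

Lemma gpow_pred k : winv g ++ gpow k ~ gpow (k - 1).
Proof.
case: k => [[|n]|n]; first exact: aeq_refl.
  by rewrite -addn1 PoszD addrK /= addn1 wpowS catA; apply: (aeq_catr _ (aeq_mulVw g)).
by rewrite NegzE -opprD -PoszD addn1 -NegzE; apply: aeq_refl.
Qed.

Lemma gpowD a b : gpow a ++ gpow b ~ gpow (a + b).
Proof.
elim: a => [|n IH|n IH].
- by rewrite add0r; apply: aeq_refl.
- rewrite [in X in _ ~ gpow X]intS [1 + _]addrC addrAC /gpow wpowS -catA.
  apply: aeq_trans (gpow_succ _); exact: aeq_catl.
- rewrite -NegzE /gpow wpowS -catA NegzE -addn1 PoszD opprD addrAC.
  apply: aeq_trans (gpow_pred _); apply: aeq_catl.
  by apply: aeq_trans IH; case: n => [|n]; apply: aeq_refl.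
Qed.

Lemma winv_gpow : winv g = gpow (-1).
Proof. by rewrite -[gpow _]/(winv g ++ [::]) cats0. Qed.

Definition gconj (k : int) (u : word V) := gpow k ++ u ++ gpow (- k).

Lemma gconj_succ k u : g ++ gconj k u ++ winv g ~ gconj (k + 1) u.
Proof.
rewrite /gconj winv_gpow -!catA (catA g); apply: aeq_cat; first exact: gpow_succ.
by apply: aeq_catl; rewrite opprD; apply: gpowD.
Qed.

End Words.

(** * Linear extension of functions on words to chains *)

Section Chains.
Variables (V : eqType) (K : fieldType).
Implicit Types c : chain V K.

Section Extension.
Variables (L : nzRingType) (s : {rmorphism K -> L}) (Y : lmodType L).

(** The map [s] lets one definition cover values in [K], in the [K[t]]-module of classes, and in row
    vectors over [F]. *)
Definition ext (f : word V -> Y) c : Y := \sum_(p <- c) s p.1 *: f p.2.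

Lemma eq_ext f f' c : f =1 f' -> ext f c = ext f' c.
Proof. by move=> ff'; apply: eq_bigr => p _; rewrite ff'. Qed.

Lemma ext_cat f c c' : ext f (c ++ c') = ext f c + ext f c'.
Proof. exact: big_cat. Qed.

Lemma ext_flatten f (cs : seq (chain V K)) :
  ext f (flatten cs) = \sum_(c <- cs) ext f c.
Proof.
elim: cs => [|c cs IH]; first by rewrite /ext !big_nil.
by rewrite /= ext_cat IH big_cons.
Qed.

Lemma ext_scalec f a c : ext f (scalec a c) = s a *: ext f c.
Proof.
rewrite /ext big_map scaler_sumr; apply: eq_bigr => p _.
by rewrite rmorphM scalerA.
Qed.

Lemma ext_conjc f h k c :
  ext f (conjc h k c) = ext (fun u => f (wpow h k ++ u ++ winv (wpow h k))) c.
Proof. by rewrite /ext big_map. Qed.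

Lemma ext_lact f g n (p : {poly K}) c : ext f (lact g (n, p) c) =
  \sum_(i < size p) s p`_i *: ext f (conjc g i (conjc (winv g) n c)).
Proof.
rewrite /lact ext_flatten big_map -(big_mkord xpredT
  (fun i => s p`_i *: ext f (conjc g i (conjc (winv g) n c)))) /index_iota subn0.
by apply: eq_bigr => i _; rewrite ext_scalec.
Qed.

(** Grouping the terms by word shows that a linear extension descends from lists to formal sums. *)
Lemma ext_coef f c c' : coef c =1 coef c' -> ext f c = ext f c'.
Proof.
(* The words of both chains together, so that both regrouped sums run over the same index list. *)
pose S := undup (map snd (c ++ c')).
have main c1 : {subset map snd c1 <= S} ->
    ext f c1 = \sum_(w <- S) s (coef c1 w) *: f w.
  move=> sub; rewrite /ext /coef.
  under [RHS]eq_bigr => w _ do rewrite rmorph_sum /= scaler_suml big_mkcond.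
  rewrite exchange_big /= big_seq_cond [RHS]big_seq_cond.
  apply: eq_bigr => p /andP[pc _].
  rewrite (bigD1_seq p.2) /= ?undup_uniq //; last first.
    by apply: sub; apply: map_f.
  by rewrite eqxx big1 ?addr0 // => w; rewrite eq_sym => /negPf ->.
move=> cc'; rewrite !main; first by apply: eq_bigr => w _; rewrite cc'.
  by move=> w wc; rewrite mem_undup map_cat mem_cat wc orbT.
by move=> w wc; rewrite mem_undup map_cat mem_cat wc.
Qed.
End Extension.

Definition indw (w u : word V) : K^o := (u == w)%:R.

Lemma coefE c w : coef c w = ext idfun (indw w) c.
Proof.
rewrite /coef /ext big_mkcond /=; apply: eq_bigr => p _.
by rewrite /indw; case: eqP; rewrite ?scaler0 // -[_ *: _]/(_ * _) mulr1.
Qed.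

(** Formal sums are compared through all [K]-valued test functions, which turns identities between
    chains into computations in [K]. *)
Lemma coef_ext c c' :
  (forall f : word V -> K^o, ext idfun f c = ext idfun f c') <-> coef c =1 coef c'.
Proof.
by split=> [H w | H f]; [rewrite !coefE | exact: ext_coef].
Qed.

End Chains.

(** * Polynomials evaluated against sequences *)

Section Moments.
Variables (K : fieldType).
Implicit Types (s : nat -> K) (p q : {poly K}).

(** The linear functional sending ['X^i] to [s i]. The action of [p] on a chain, seen through a test
    function, has this form. *)
Definition moment s p : K := \sum_(i < size p) p`_i * s i.

Lemma moment_widen s p n : (size p <= n)%N -> moment s p = \sum_(i < n) p`_i * s i.
Proof.
move=> le_pn; rewrite /moment (big_ord_widen _ (fun i => p`_i * s i) le_pn).
rewrite big_mkcond; apply: eq_bigr => i _; case: ltnP => // le_pi.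
by rewrite nth_default ?mul0r.
Qed.

Lemma momentD s p q : moment s (p + q) = moment s p + moment s q.
Proof.
rewrite !(@moment_widen _ _ (maxn (size p) (size q))) ?leq_maxl ?leq_maxr //.
  by rewrite -big_split; apply: eq_bigr => i _; rewrite coefD mulrDl.
exact: size_polyD.
Qed.

Lemma momentZ s a p : moment s (a *: p) = a * moment s p.
Proof.
rewrite (moment_widen _ (size_scale_leq a p)) mulr_sumr.
by apply: eq_bigr => i _; rewrite coefZ mulrA.
Qed.

Lemma momentC s a : moment s a%:P = a * s 0%N.
Proof. by rewrite (moment_widen s (size_polyC_leq1 a)) big_ord1 coefC. Qed.

Lemma momentMX s p : moment s (p * 'X) = moment (fun i => s i.+1) p.
Proof.
rewrite (@moment_widen _ _ (size p).+1); last first.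
  by rewrite (leq_trans (size_polyMleq _ _)) ?size_polyX ?addn2.
rewrite big_ord_recl coefMX mul0r add0r.
by apply: eq_bigr => i _; rewrite coefMX.
Qed.

(** The source of associativity of the polynomial action. *)
Lemma momentM s p q :
  moment s (p * q) = moment (fun i => moment (fun j => s (i + j)%N) q) p.
Proof.
elim/poly_ind: p s => [|p a IH] s; first by rewrite mul0r /moment size_poly0 !big_ord0.
by rewrite mulrDl mul_polyC momentD momentZ mulrAC momentMX IH momentD momentMX
  momentC.
Qed.

End Moments.

(** * First homology as a quotient module over [K[t]] *)

Section H1Module.
Variables (V : choiceType) (adj : rel V) (lt : V -> V -> nat) (m : V -> int).
Variables (K : fieldType) (g : word V).
Local Notation chain := (chain V K).
Local Notation hz := (@h1zero V adj lt m K).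
Local Notation "u ~ w" := (aeq adj lt u w) (at level 70).
Implicit Types c : chain.

Lemma chi_cat (u w : word V) : chi m (u ++ w) = chi m u + chi m w.
Proof. exact: big_cat. Qed.

Lemma chi_winv (u : word V) : chi m (winv u) = - chi m u.
Proof.
rewrite /winv /chi (perm_big _ (introT permPl (perm_rev _))) big_map -sumrN.
by apply: eq_bigr => -[v []] _ /=; rewrite ?opprK.
Qed.

Lemma chi_conj (h u : word V) : chi m (h ++ u ++ winv h) = chi m u.
Proof. by rewrite !chi_cat chi_winv addrC subrK. Qed.

Lemma h1zero_coef c c' : coef c =1 coef c' -> hz c -> hz c'.
Proof. by move=> cc' [r [rr cr]]; exists r; split=> // w; rewrite -cc'. Qed.

Lemma h1zero_rel c : h1rel adj lt m c -> hz c.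
Proof. by move=> cr; exists c. Qed.

Lemma h1zero_nil : hz [::].
Proof. exact/h1zero_rel/h1rel_nil. Qed.

Lemma coef_cat c c' w : coef (c ++ c') w = coef c w + coef c' w.
Proof. by rewrite !coefE ext_cat. Qed.

Lemma h1zero_cat c c' : hz c -> hz c' -> hz (c ++ c').
Proof.
move=> [r [rr cr]] [r' [rr' cr']]; exists (r ++ r'); split.
  exact: h1rel_cat.
by move=> w; rewrite !coef_cat cr cr'.
Qed.

Lemma h1zero_scalec a c : hz c -> hz (scalec a c).
Proof.
move=> [r [rr cr]]; exists (scalec a r); split; last first.
  by move=> w; rewrite !coefE !ext_scalec -!coefE cr.
elim: rr => [|b u w u0 w0|b u w u0 uw|r1 r2 _ IH1 _ IH2] /=.
- exact: h1rel_nil.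
- by rewrite mulrN; apply: h1rel_mul.
- by rewrite mulrN; apply: h1rel_eq.
- by rewrite /scalec map_cat; apply: h1rel_cat.
Qed.

Lemma h1zero_conjc h k c : hz c -> hz (conjc h k c).
Proof.
suff main r : h1rel adj lt m r -> hz (conjc h k r).
  move=> [r [/main rr cr]]; apply: h1zero_coef rr; apply/coef_ext => f.
  by rewrite !ext_conjc; apply: ext_coef => w; rewrite cr.
set H := wpow h k; pose C (u : word V) := H ++ u ++ winv H.
have chiC u : chi m (C u) = chi m u by exact: chi_conj.
elim=> [|b u w u0 w0|b u w u0 uw|r1 r2 _ IH1 _ IH2].
- exact: h1zero_nil.
- have CM : C u ++ C w ~ C (u ++ w).
    rewrite /C -!catA; do 2 apply: aeq_catl.
    by rewrite catA; apply: (aeq_catr _ (aeq_mulVw _ _ _)).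
  (* The conjugate of a product relation is a product relation for the conjugates, corrected by
     cancelling [winv H ++ H] in the middle. *)
  apply: (@h1zero_coef
    ([:: (b, C u); (b, C w); (- b, C u ++ C w)] ++
     [:: (b, C u ++ C w); (- b, C (u ++ w))])); last first.
    apply: h1zero_cat; apply: h1zero_rel.
      by apply: h1rel_mul; rewrite chiC.
    by apply: h1rel_eq => //; rewrite chi_cat !chiC u0 w0.
  apply/coef_ext => f; rewrite ext_cat /ext !big_cons !big_nil /= !addr0.
  by rewrite scaleNr addrA addrA subrK addrA.
- apply: h1zero_rel; apply: h1rel_eq; first by rewrite chi_conj.
  exact: aeq_ctx.
- by rewrite /conjc map_cat; apply: h1zero_cat.
Qed.

Lemma h1zero_lact l c : hz c -> hz (lact g l c).
Proof.
move=> cz; rewrite /lact; elim: (iota _ _) => [|i s IH] /=; first exact: h1zero_nil.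
by apply: h1zero_cat IH; apply/h1zero_scalec/h1zero_conjc/h1zero_conjc.
Qed.

(** Made Boolean by classical reflection, as the quotient construction requires. Words outside the
    kernel also occur in the carrier; the relations only involve kernel words. *)
Definition h1equiv : rel chain := fun c c' => `[< hz (c ++ scalec (-1) c') >].

Lemma h1equiv_is_equiv : equiv_class_of h1equiv.
Proof.
split=> [c|c c'|c' c c''].
- apply/asboolP; apply: h1zero_coef h1zero_nil; apply/coef_ext => f.
  by rewrite ext_cat ext_scalec scaleN1r subrr /ext big_nil.
- suff main c1 c2 : h1equiv c1 c2 -> h1equiv c2 c1 by apply/idP/idP; apply: main.
  move=> /asboolP/(h1zero_scalec (-1)) cz; apply/asboolP.
  apply: h1zero_coef cz; apply/coef_ext => f.
  by rewrite !(ext_cat, ext_scalec) !scaleN1r opprB.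
- move=> /asboolP cz /asboolP cz'; apply/asboolP.
  apply: h1zero_coef (h1zero_cat cz cz'); apply/coef_ext => f.
  by rewrite !(ext_cat, ext_scalec) !scaleN1r addrA subrK.
Qed.

Canonical h1equiv_equiv := EquivRelPack h1equiv_is_equiv.
Canonical h1equiv_encModRel := defaultEncModRel h1equiv.

(* The word [h] selects the action of [t] and does not affect the carrier. *)
Definition H1mod_of (h : word V) := {eq_quot h1equiv}%qT.
Local Notation H1mod := (H1mod_of g).

HB.instance Definition _ : EqQuotient chain h1equiv H1mod := EqQuotient.on H1mod.
HB.instance Definition _ := Choice.on H1mod.

Definition cl c : H1mod := \pi_H1mod%qT c.

Lemma cl_eq c c' : cl c = cl c' <-> hz (c ++ scalec (-1) c').
Proof.
by split=> [/eqmodP/asboolP|H] //; apply/eqmodP/asboolP.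
Qed.

Lemma cl_coef c c' : coef c =1 coef c' -> cl c = cl c'.
Proof.
move=> cc'; apply/cl_eq; apply: h1zero_coef h1zero_nil; apply/coef_ext => f.
by rewrite ext_cat (ext_coef _ _ cc') ext_scalec scaleN1r subrr /ext big_nil.
Qed.

Lemma cl_repr (x : H1mod) : cl (repr x) = x.
Proof. exact: reprK. Qed.

Definition h1add (x y : H1mod) := cl (repr x ++ repr y).
Definition h1scale (p : {poly K}) (x : H1mod) := cl (lact g (0%N, p) (repr x)).
Definition h1opp (x : H1mod) := cl (scalec (-1) (repr x)).

Lemma cl_cat c c' : cl (c ++ c') = h1add (cl c) (cl c').
Proof.
have [/esym/cl_eq cz /esym/cl_eq cz'] := (cl_repr (cl c), cl_repr (cl c')).
apply/cl_eq; apply: h1zero_coef (h1zero_cat cz cz'); apply/coef_ext => f.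
by rewrite !(ext_cat, ext_scalec) !scaleN1r opprD addrACA.
Qed.

Lemma conjc0 h c : conjc h 0 c = c.
Proof. by rewrite -[RHS]map_id; apply: eq_map => -[a u]; rewrite /= cats0. Qed.

(** Reduces the module axioms to identities between moments. *)
Lemma ext_lact0 (f : word V -> K^o) p c : ext idfun f (lact g (0%N, p) c) =
  moment (fun i => ext idfun (fun u => f (wpow g i ++ u ++ winv (wpow g i))) c) p.
Proof.
rewrite ext_lact conjc0; apply: eq_bigr => i _.
by rewrite ext_conjc.
Qed.

Lemma moment_eq (s s' : nat -> K) p : s =1 s' -> moment s p = moment s' p.
Proof. by move=> ss'; apply: eq_bigr => i _; rewrite ss'. Qed.

Lemma cl_lact0 p c : cl (lact g (0%N, p) c) = h1scale p (cl c).
Proof.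
have /esym/cl_eq/(h1zero_lact (0%N, p)) cz := cl_repr (cl c).
apply/cl_eq; apply: h1zero_coef cz; apply/coef_ext => f.
rewrite ext_cat ext_scalec !ext_lact0 scaleN1r.
rewrite /moment -sumrN -big_split; apply: eq_bigr => i _.
by rewrite ext_cat ext_scalec scaleN1r mulrDr mulrN.
Qed.

Lemma h1addA : associative h1add.
Proof.
by move=> x y z; rewrite -[x]cl_repr -[y]cl_repr -[z]cl_repr -!cl_cat catA.
Qed.

Lemma h1addC : commutative h1add.
Proof.
move=> x y; rewrite -[x]cl_repr -[y]cl_repr -!cl_cat; apply/cl_coef/coef_ext => f.
by rewrite !ext_cat addrC.
Qed.

Lemma h1add0 : left_id (cl [::]) h1add.
Proof. by move=> x; rewrite -[x]cl_repr -cl_cat. Qed.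

Lemma h1addN : left_inverse (cl [::]) h1opp h1add.
Proof.
move=> x; rewrite -{2}[x]cl_repr /h1opp -cl_cat; apply/cl_coef/coef_ext => f.
by rewrite ext_cat ext_scalec scaleN1r addNr /ext big_nil.
Qed.

HB.instance Definition _ := GRing.isZmodule.Build H1mod h1addA h1addC h1add0 h1addN.

Lemma h1scaleA p q (x : H1mod) : h1scale p (h1scale q x) = h1scale (p * q) x.
Proof.
rewrite [h1scale q x]/h1scale -cl_lact0; apply/cl_coef/coef_ext => f.
rewrite !ext_lact0 momentM; apply: moment_eq => i.
rewrite ext_lact0; apply: moment_eq => j; apply: (@eq_ext _ _ _ _ K^o) => u.
by rewrite wpowD winv_cat !catA.
Qed.

Lemma h1scale1 : left_id 1 h1scale.
Proof.
move=> x; rewrite -[RHS]cl_repr; apply/cl_coef/coef_ext => f.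
rewrite ext_lact0 -polyC1 momentC mul1r; apply: (@eq_ext _ _ _ _ K^o) => u.
by rewrite /= cats0.
Qed.

Lemma h1scaleDr : right_distributive h1scale +%R.
Proof.
move=> p x y; rewrite -[_ + _]/(h1add _ _) -[RHS]/(h1add _ _).
rewrite -[x]cl_repr -[y]cl_repr -cl_cat -!cl_lact0 -cl_cat.
apply/cl_coef/coef_ext => f; rewrite ext_cat !ext_lact0 /moment -big_split.
by apply: eq_bigr => i _; rewrite ext_cat mulrDr.
Qed.

Lemma h1scaleDl x : {morph h1scale^~ x : p q / p + q}.
Proof.
move=> p q; rewrite -[RHS]/(h1add _ _) -cl_cat; apply/cl_coef/coef_ext => f.
by rewrite ext_cat !ext_lact0 momentD.
Qed.

HB.instance Definition _ := GRing.Zmodule_isLmodule.Build {poly K} H1mod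
  h1scaleA h1scale1 h1scaleDr h1scaleDl.

Definition cl1 (u : word V) : H1mod := cl [:: (1, u)].

Lemma cl_ext c : cl c = ext polyC cl1 c.
Proof.
elim: c => [|[a u] c IH]; first by rewrite /ext big_nil.
rewrite -cat1s cl_cat ext_cat IH; congr (_ + _).
rewrite /ext big_seq1 -[_ *: _]/(h1scale _ _) -cl_lact0.
apply/cl_coef/coef_ext => f; rewrite ext_lact0 momentC /ext !big_seq1 /=.
by rewrite cats0 scale1r.
Qed.

Lemma h1zeroP c : hz c <-> cl c = 0.
Proof.
rewrite -[0]/(cl [::]); split=> [cz|/cl_eq]; first by apply/cl_eq; rewrite cats0.
by rewrite cats0.
Qed.

Lemma cl1_cat u w : chi m u = 0 -> chi m w = 0 -> cl1 (u ++ w) = cl1 u + cl1 w.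
Proof.
move=> u0 w0; have /h1zero_rel/h1zeroP := h1rel_mul adj lt (1 : K) u0 w0.
rewrite cl_ext /ext !big_cons big_nil /= addr0 polyCN scaleNr !scale1r addrA.
by move/eqP; rewrite subr_eq0 => /eqP.
Qed.

Lemma cl1_aeq u w : chi m u = 0 -> u ~ w -> cl1 u = cl1 w.
Proof.
move=> u0 uw; have /h1zero_rel/h1zeroP := h1rel_eq (1 : K) u0 uw.
rewrite cl_ext /ext !big_cons big_nil /= addr0 polyCN scaleNr !scale1r.
by move/eqP; rewrite subr_eq0 => /eqP.
Qed.

Lemma cl1_nil : cl1 [::] = 0.
Proof.
have chi0 : chi m (Nil (V * bool)) = 0 by exact: big_nil.
by apply: (addrI (cl1 [::])); rewrite addr0 -(cl1_cat chi0 chi0).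
Qed.

Lemma cl1_conj u : cl1 (g ++ u ++ winv g) = 'X *: cl1 u.
Proof.
rewrite -[RHS]/(h1scale _ _) -cl_lact0; apply/cl_coef/coef_ext => f.
rewrite ext_lact0 -['X]mul1r momentMX -polyC1 momentC mul1r.
have w1 : wpow g 1 = g by exact: cats0.
by rewrite /ext !big_seq1 w1.
Qed.

End H1Module.

(** * Fox calculus and the presentation of the module *)

Section Fox.
Variables (V : finType) (adj : rel V) (lt : V -> V -> nat) (m : V -> int).
Variables (K : fieldType) (g : word V).
Hypothesis chi_g_dvd : forall w : word V, (chi m g %| chi m w)%Z.
Hypothesis chi_g_neq0 : chi m g != 0.
Local Notation F := {fraction {poly K}}.
Local Notation "u ~ w" := (aeq adj lt u w) (at level 70).
Local Notation cl1 := (@cl1 V adj lt m K g).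
Local Notation cl := (@cl V adj lt m K g).

(* Degrees are normalised so that [g] has degree one. *)
Definition gdeg (v : V) : int := (m v %/ chi m g)%Z.
Local Notation deg := (chi gdeg).

Lemma gdegE v : gdeg v * chi m g = m v.
Proof.
apply: divzK; have := chi_g_dvd [:: (v, false)].
by rewrite [chi m [:: _]]/chi big_seq1.
Qed.

Lemma degE u : deg u * chi m g = chi m u.
Proof.
rewrite /chi mulr_suml; apply: eq_bigr => -[v b] _ /=.
by rewrite -[in RHS]gdegE; case: b; rewrite ?mulNr.
Qed.

Lemma deg_g : deg g = 1.
Proof. by apply: (mulIf chi_g_neq0); rewrite degE mul1r. Qed.

Lemma deg_eq0 u : (deg u == 0) = (chi m u == 0).
Proof. by rewrite -degE mulf_eq0 (negPf chi_g_neq0) orbF. Qed.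

Lemma gdeg_eq0 v : (gdeg v == 0) = (m v == 0).
Proof. by rewrite -[m v]gdegE mulf_eq0 (negPf chi_g_neq0) orbF. Qed.

Lemma deg_cons l u : deg (l :: u) = deg [:: l] + deg u.
Proof. by rewrite -cat1s chi_cat. Qed.

Lemma deg_wpow h n : deg (wpow h n) = deg h *+ n.
Proof.
elim: n => [|n IH]; first by rewrite /chi big_nil.
by rewrite wpowS chi_cat IH mulrS.
Qed.

Lemma deg_gpow k : deg (gpow g k) = k.
Proof. by case: k => n; rewrite deg_wpow ?chi_winv deg_g ?NegzE ?mulNrn natz. Qed.

Lemma deg_gconj k u : deg (gconj g k u) = deg u.
Proof. by rewrite !chi_cat !deg_gpow addrC subrK. Qed.

Local Notation t := ('X : {poly K})%:F.

Lemma tofracX_neq0 : t != 0.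
Proof. by rewrite tofrac_eq0 polyX_eq0. Qed.
Local Notation t0 := tofracX_neq0.

(** Since [t] is not a root of unity, [1 - t ^ gdeg v] vanishes only at resonant vertices. *)
Lemma tofracX_expz_eq1 k : (t ^ k == 1) = (k == 0).
Proof.
have pos n : (t ^+ n == 1) = (n == 0%N).
  rewrite -tofracXn -tofrac1 tofrac_eq; case: n => [|n]; first by rewrite expr0 eqxx.
  apply/eqP => /(congr1 (fun p : {poly K} => size p)).
  by rewrite size_polyXn size_poly1.
case: k => n; first by rewrite -exprnP pos.
by rewrite NegzE -exprnN invr_eq1 pos.
Qed.

Definition fox_gen (v : V) : 'rV[F]_#|V| := delta_mx 0 (enum_rank v).

(** The value on an inverse letter is forced by the product rule applied to a cancelling pair. *)
Definition fox_letter (l : V * bool) : 'rV[F]_#|V| :=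
  if l.2 then - t ^ (- gdeg l.1) *: fox_gen l.1 else fox_gen l.1.

(* The row of Fox derivatives of a word, abelianised to [F] by the degree. *)
Definition fox (u : word V) : 'rV[F]_#|V| :=
  foldr (fun l q => fox_letter l + t ^ deg [:: l] *: q) 0 u.

Lemma fox_cat u w : fox (u ++ w) = fox u + t ^ deg u *: fox w.
Proof.
elim: u => [|l u IH]; first by rewrite /chi big_nil expr0z scale1r add0r.
rewrite [fox (_ ++ _)]/= -/(fox _) IH scalerDr addrA scalerA -expfzDr ?t0 //.
by rewrite -deg_cons.
Qed.

Lemma fox_letterE l : fox [:: l] = fox_letter l.
Proof. by rewrite /= scaler0 addr0. Qed.

Lemma fox_free v b : fox [:: (v, b); (v, ~~ b)] = 0.
Proof.
rewrite /= scaler0 addr0 /chi big_seq1 /= /fox_letter /=; case: b => /=.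
  by rewrite scaleNr addNr.
by rewrite scalerA mulrN -expfzDr ?t0 // subrr expr0z scaleN1r subrr.
Qed.

Lemma fox_mulwV u : fox (u ++ winv u) = 0.
Proof.
elim: u => [//|[v b] u IH].
rewrite -cat1s winv_cat -catA (catA u) 2!fox_cat IH add0r.
rewrite chi_cat chi_winv subrr expr0z scale1r -fox_cat.
exact: fox_free.
Qed.

Lemma fox_winv u : fox (winv u) = - t ^ (- deg u) *: fox u.
Proof.
have /eqP := fox_mulwV u; rewrite fox_cat addrC addr_eq0 => /eqP Hu.
by rewrite scaleNr -scalerN -Hu scalerA -expfzDr ?t0 // addNr expr0z scale1r.
Qed.

(** As [u] has degree zero, the contributions of [h] and [winv h] cancel. *)
Lemma fox_conj h u : deg u = 0 ->
  fox (h ++ u ++ winv h) = t ^ deg h *: fox u.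
Proof.
move=> u0; rewrite !fox_cat u0 expr0z scale1r fox_winv scalerDr scalerA mulrN.
by rewrite -expfzDr ?t0 // subrr expr0z scaleN1r addrCA subrr addr0.
Qed.

(** Proportionality suffices: a matrix that kills [fox g] kills the Fox row of every power of
    [g]. *)
Lemma fox_gpow k : exists a, fox (gpow g k) = a *: fox g.
Proof.
have pos h n : exists a, fox (wpow h n) = a *: fox h.
  elim: n => [|n [a IH]]; first by exists 0; rewrite scale0r.
  by exists (1 + t ^ deg h * a); rewrite wpowS fox_cat IH scalerDl scale1r scalerA.
case: k => n; first exact: pos.
have [a ->] := pos (winv g) n.+1.
by rewrite fox_winv scalerA; eexists.
Qed.

(** The fundamental formula of Fox calculus. Both sides obey the product rule, which reduces the
    claim to single letters. *)
Lemma fox_fundamental u :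
  \sum_v fox u 0 (enum_rank v) * (1 - t ^ gdeg v) = 1 - t ^ deg u.
Proof.
elim: u => [|[v b] u IH].
  by rewrite /chi big_nil expr0z subrr big1 // => v _; rewrite mxE mul0r.
rewrite deg_cons expfzDr ?t0 //=.
under eq_bigr => w _ do rewrite !mxE mulrDl -mulrA.
rewrite big_split -mulr_sumr IH /=.
have gen v' : \sum_w fox_gen v' 0 (enum_rank w) * (1 - t ^ gdeg w) = 1 - t ^ gdeg v'.
  rewrite (bigD1 v') //= mxE !eqxx mul1r big1 ?addr0 // => w wv.
  by rewrite mxE (inj_eq enum_rank_inj) (negPf wv) andbF mul0r.
have -> : \sum_w fox_letter (v, b) 0 (enum_rank w) * (1 - t ^ gdeg w)
    = 1 - t ^ deg [:: (v, b)].
  rewrite /chi big_seq1 /fox_letter /=; case: b => /=; last exact: gen.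
  under eq_bigr => w _ do rewrite mxE -mulrA.
  rewrite -mulr_sumr gen mulrBr mulr1 mulNr -expfzDr ?t0 // addNr expr0z.
  by rewrite opprK addrC.
by rewrite mulrBr mulr1 addrA subrK.
Qed.

(** With [T = t ^ (gdeg v + gdeg w)] this is [(T^n - 1) / (T - 1)], kept as a sum because [T] may be
    1. *)
Definition cyclo_sum (v w : V) (n : nat) : F :=
  \sum_(i < n) (t ^ (gdeg v + gdeg w)) ^+ i.

Lemma fox_artin v w n : fox (artin_rel v w n) =
  cyclo_sum v w n *: (fox_gen v + t ^ gdeg v *: fox_gen w).
Proof.
have degvw : deg [:: (v, false); (w, false)] = gdeg v + gdeg w.
  by rewrite /chi big_cons big_seq1.
rewrite /cyclo_sum /artin_rel; elim: n => [|n IH].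
  by rewrite big_ord0 scale0r.
rewrite wpowS fox_cat IH big_ord_recl expr0 scalerDl scale1r scalerA degvw.
congr (_ + _ *: _); last first.
  by rewrite mulr_sumr; apply: eq_bigr => i _; rewrite exprS.
by rewrite /= scaler0 addr0 /chi big_seq1.
Qed.

(** The factor [cyclo_sum] is symmetric in [v] and [w]; what remains is the Fox row of the
    commutator of the two generators. *)
Lemma fox_artin_rel v w n :
  fox (artin_rel v w n) - fox (artin_rel w v n) =
  cyclo_sum v w n *:
    ((1 - t ^ gdeg w) *: fox_gen v - (1 - t ^ gdeg v) *: fox_gen w).
Proof.
rewrite !fox_artin {2}/cyclo_sum [gdeg w + _]addrC -/(cyclo_sum v w n) -scalerBr.
congr (_ *: _); rewrite !scalerBl !scale1r !opprD opprK.
by rewrite [- _ - _]addrC addrACA [_ *: _ - _]addrC.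
Qed.

(** If the base of the powers is 1, the sum is the image of [n] in [K]. Otherwise its vanishing
    would make the base an [n]-th root of unity. *)
Lemma cyclo_sum_neq0 v w n : (0 < n)%N ->
  ~~ ((m v + m w == 0) && (n%:R == 0 :> K)) -> cyclo_sum v w n != 0.
Proof.
move=> n0 Hres; rewrite /cyclo_sum.
have degvw : (gdeg v + gdeg w == 0) = (m v + m w == 0).
  by rewrite -!gdegE -mulrDl mulf_eq0 (negPf chi_g_neq0) orbF.
move: Hres; rewrite -degvw; set k := gdeg v + gdeg w.
have [-> /= nK|k0 _] := eqVneq k 0.
  under eq_bigr => i _ do rewrite expr0z expr1n.
  rewrite sumr_const card_ord -[1]tofrac1 -tofracMn tofrac_eq0.
  by rewrite -polyC1 -polyCMn polyC_eq0.
apply: contraTneq (k0) => s0; rewrite negbK.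
have /eqP : (t ^ k) ^+ n - 1 = 0 by rewrite subrX1 s0 mulr0.
rewrite subr_eq0 exprnP exprz_exp tofracX_expz_eq1.
by rewrite mulf_eq0 => /orP[// | /eqP[n1]]; rewrite n1 in n0.
Qed.

Lemma aeq_deg u w : u ~ w -> deg u = deg w.
Proof.
elim=> {u w} [//|//|u w x _ -> _ -> //|a b u w _ IH|v b|v w vw].
- by rewrite !chi_cat IH.
- by rewrite /chi big_cons big_seq1 big_nil; case: b; rewrite /= ?subrr ?addNr.
- rewrite /artin_rel; elim: (lt v w) => // n IH.
  by rewrite !wpowS !chi_cat IH /chi !big_cons !big_nil /= [gdeg v + _]addrCA.
Qed.

Definition bra (u : word V) : word V := u ++ gpow g (- deg u).
Definition xgen (i : 'I_#|V|) := cl1 (bra [:: (enum_val i, false)]).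

Lemma chi_bra u : chi m (bra u) = 0.
Proof. by apply/eqP; rewrite -deg_eq0 chi_cat deg_gpow subrr. Qed.

Lemma chi_gconj k u : chi m u = 0 -> chi m (gconj g k u) = 0.
Proof. by move/eqP; rewrite -deg_eq0 => u0; apply/eqP; rewrite -deg_eq0 deg_gconj. Qed.

Lemma cl1_gconjS k u : chi m u = 0 ->
  'X *: cl1 (gconj g k u) = cl1 (gconj g (k + 1) u).
Proof.
move=> u0; rewrite -cl1_conj; apply: cl1_aeq; last exact: gconj_succ.
by rewrite chi_conj chi_gconj.
Qed.

Lemma fcoord_gconj k u q : chi m u = 0 ->
  fcoord xgen (cl1 u) q -> fcoord xgen (cl1 (gconj g k u)) (t ^ k *: q).
Proof.
move=> u0 Hu; elim: k => [|n IH|n IH].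
- by rewrite expr0z scale1r /gconj oppr0 /= cats0.
- rewrite intS addrC -cl1_gconjS // expfzDr ?t0 // mulrC -scalerA.
  exact: fcoordZ.
(* Only [K[t]] acts, so a negative power is reached by multiplying with ['X] and cancelling it. *)
- apply: (@fcoordZK _ _ _ _ 'X); first by rewrite polyX_eq0.
  rewrite cl1_gconjS // scalerA -[X in X * _]expr1z -expfzDr ?t0 //.
  by rewrite [1 + _]addrC intS opprD addrAC addNr add0r.
Qed.

(** The cocycle rule, with conjugation by the power [deg u] of [g] in the role of [t ^ deg u]. *)
Lemma cl1_bra_cat u w :
  cl1 (bra (u ++ w)) = cl1 (bra u) + cl1 (gconj g (deg u) (bra w)).
Proof.
rewrite -cl1_cat ?chi_gconj ?chi_bra //.
apply: cl1_aeq; first exact: chi_bra.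
apply: aeq_sym; rewrite /gconj /bra -!catA; apply: aeq_catl.
rewrite (catA (gpow g (- deg u))) chi_cat opprD [- _ - _]addrC.
apply: (@aeq_trans _ _ _ _ ([::] ++ w ++ gpow g (- deg w) ++ gpow g (- deg u))).
  by apply: aeq_catr; have := gpowD adj lt g (- deg u) (deg u); rewrite addNr.
exact: (aeq_catl w (gpowD _ _ _ _ _)).
Qed.

Lemma cl1_bra_aeq u w : u ~ w -> cl1 (bra u) = cl1 (bra w).
Proof.
move=> uw; apply: cl1_aeq; first exact: chi_bra.
by rewrite /bra (aeq_deg uw); apply: aeq_catr.
Qed.

Lemma bra_nil : bra [::] = [::].
Proof. by rewrite /bra /chi big_nil. Qed.

(** The classes and the Fox rows obey the same product rule, so agreement on letters is enough. *)
Lemma fcoord_bra u : fcoord xgen (cl1 (bra u)) (fox u).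
Proof.
have Hgen v : fcoord xgen (cl1 (bra [:: (v, false)])) (fox_gen v).
  by have := fcoord_gen xgen (enum_rank v); rewrite /xgen enum_rankK.
have Hletter l : fcoord xgen (cl1 (bra [:: l])) (fox_letter l).
  (* The class of an inverse letter is solved for from its cancellation with the letter. *)
  case: l => v [] //; rewrite /fox_letter /= scaleNr.
  have := cl1_bra_cat [:: (v, true)] [:: (v, false)].
  rewrite (cl1_bra_aeq (aeq_free adj lt v true)) bra_nil cl1_nil => /esym/eqP.
  rewrite addr_eq0 => /eqP ->; apply: fcoordN.
  have -> : deg [:: (v, true)] = - gdeg v by rewrite /chi big_seq1.
  by apply: fcoord_gconj => //; apply: chi_bra.
elim: u => [|l u IH]; first by rewrite bra_nil cl1_nil; apply: fcoord0.
rewrite -cat1s cl1_bra_cat; apply: fcoordD; first exact: Hletter.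
by apply: fcoord_gconj => //; apply: chi_bra.
Qed.

Lemma fcoord_artin v w : adj v w ->
  fcoord xgen 0 (fox (artin_rel v w (lt v w)) - fox (artin_rel w v (lt v w))).
Proof.
move=> vw; have := fcoordD (fcoord_bra (artin_rel v w (lt v w)))
  (fcoordN (fcoord_bra (artin_rel w v (lt v w)))).
by rewrite (cl1_bra_aeq (aeq_artin lt vw)) subrr.
Qed.

(** The one relation not coming from an edge: [bra g] is [g] followed by its inverse. *)
Lemma fcoord_fox_g : fcoord xgen 0 (fox g).
Proof.
have := fcoord_bra g; rewrite /bra deg_g -winv_gpow.
rewrite (@cl1_aeq _ _ _ _ _ _ _ [::]) ?cl1_nil //; last exact: aeq_mulwV.
by rewrite chi_cat chi_winv subrr.
Qed.

Definition tofracC : {rmorphism K -> F} := (@FracField.tofrac {poly K}) \o polyC.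

Definition foxc (c : chain V K) : 'rV[F]_#|V| := ext tofracC fox c.

Lemma fcoord_foxc c : is_chain m c -> fcoord xgen (cl c) (foxc c).
Proof.
rewrite cl_ext /foxc /ext; elim: c => [_|[a u] c IH /andP[/eqP u0 /IH Hc]].
  by rewrite !big_nil; apply: fcoord0.
rewrite !big_cons; apply: fcoordD Hc; apply: fcoordZ.
have := fcoord_bra u; rewrite /bra.
have /eqP -> : deg u == 0 by rewrite deg_eq0 u0.
by rewrite oppr0 /= cats0.
Qed.

End Fox.

(** * The solution space of the Fox relations over the fraction field *)

Lemma mulfVMr (L : fieldType) (a b : L) : b != 0 -> (a * b)^-1 * b = a^-1.
Proof. by move=> b0; rewrite invfM mulfVK. Qed.

Lemma mulfVMl (L : fieldType) (a b : L) : a != 0 -> (a * b)^-1 * a = b^-1.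
Proof. by rewrite [a * b]mulrC; apply: mulfVMr. Qed.

Section Rank.
Variables (V : finType) (adj : rel V) (lt : V -> V -> nat) (m : V -> int).
Variables (K : fieldType) (g : word V).
Hypothesis chi_g_dvd : forall w : word V, (chi m g %| chi m w)%Z.
Hypothesis chi_g_neq0 : chi m g != 0.
Hypothesis adj_sym : symmetric adj.
Hypothesis lt_sym : forall v w, adj v w -> lt v w = lt w v.
Hypothesis lt_gt0 : forall v w, adj v w -> (0 < lt v w)%N.
Local Notation F := {fraction {poly K}}.
Local Notation t := ('X : {poly K})%:F.
Local Notation gdeg := (gdeg m g).
Local Notation fox := (@fox V m K g).
Local Notation fox_gen := (@fox_gen V K).
Local Notation cyclo_sum := (cyclo_sum m K g).
Local Notation x := (xgen adj lt m K g).
Local Notation V1 := (V1 adj m).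
Local Notation E1 := (E1 adj lt m K).
Local Notation A := [predI roots E1 & V1].

Lemma sub1_expz_eq0 v : (1 - t ^ gdeg v == 0) = VR m v.
Proof. by rewrite subr_eq0 eq_sym tofracX_expz_eq1 gdeg_eq0. Qed.

Lemma E1_sym : symmetric E1.
Proof.
suff main v w : E1 v w -> E1 w v by move=> v w; apply/idP/idP; apply: main.
move=> /and5P[vw V1v V1w nVR nER]; apply/and5P; split=> //.
- by rewrite adj_sym.
- by rewrite andbC.
- by rewrite /ER addrC -lt_sym.
Qed.

(** If [v] were resonant, [w] would not be, as edges between resonant vertices are deleted; but then
    [v] itself would be deleted. *)
Lemma E1_nonresonant v w : E1 v w -> ~~ VR m v.
Proof.
move=> /and5P[vw V1v _ nVR _]; apply: contra nVR => VRv; rewrite VRv /=.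
move: V1v; rewrite /Defs.V1 VRv /= negb_exists => /forallP/(_ w).
by rewrite vw negbK.
Qed.

Lemma E1_csym : connect_sym E1.
Proof. exact: sym_connect_sym E1_sym. Qed.

Lemma connect_V1 v w : connect E1 v w -> V1 v = V1 w.
Proof.
apply: (@closed_connect _ E1 V1) => {}v {}w /and5P[_ V1v V1w _ _].
by apply/idP/idP => _; [exact: V1w | exact: V1v].
Qed.

(** Resonant vertices that survive in [Gamma_1] are isolated there. *)
Lemma connect_VR v w : connect E1 v w -> VR m v = VR m w.
Proof.
apply: (@closed_connect _ E1 (VR m)) => {}v {}w vw.
have wv : E1 w v by rewrite E1_sym.
apply/idP/idP; apply: contraTT => _; first exact: E1_nonresonant vw.
exact: E1_nonresonant wv.
Qed.

Lemma root_in_comp v : V1 v -> fingraph.root E1 v \in A.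
Proof.
move=> V1v; apply/andP; split; first exact: roots_root E1_csym _.
by have := V1v; rewrite (connect_V1 (connect_root E1 v)).
Qed.

(** An edge of [Gamma_1] forces the values of a solution at its ends to be proportional to
    [1 - t ^ gdeg v]. At a resonant vertex this would be 0, and 1 replaces it. *)
Definition weight (v : V) : F := if VR m v then 1 else 1 - t ^ gdeg v.

Lemma weight_neq0 v : weight v != 0.
Proof.
by rewrite /weight; case: ifPn => [_|]; rewrite ?oner_neq0 ?sub1_expz_eq0.
Qed.

Lemma cyclo_sum_eq0 v w n : m v + m w = 0 -> n%:R = 0 :> K -> cyclo_sum v w n = 0.
Proof.
move=> mvw nK; have -> : cyclo_sum v w n = (n%:R)%:P%:F.
  have /eqP vw0 : gdeg v + gdeg w == 0.
    rewrite -(mulIr_eq0 _ (mulIf chi_g_neq0)) mulrDl !gdegE //.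
    exact/eqP.
  rewrite /cyclo_sum vw0; under eq_bigr do rewrite expr0z expr1n.
  by rewrite sumr_const card_ord -tofrac1 -tofracMn polyCMn polyC1.
by rewrite nK polyC0 tofrac0.
Qed.

(* Columns of [comp_mx] are the solutions of the Fox relations of the edges:
   one for every component of [Gamma_1], supported on that component. *)
Definition comp_mx : 'M[F]_(#|V|, #|A|) := \matrix_(i, j)
  (weight (enum_val i) *+
     (V1 (enum_val i) && (fingraph.root E1 (enum_val i) == enum_val j))).

(** Reads a solution at the root of each component, normalised so as to be a left inverse of
    [comp_mx]. *)
Definition root_mx : 'M[F]_(#|A|, #|V|) :=
  \matrix_j ((weight (enum_val j))^-1 *: fox_gen (enum_val j)).

Lemma fox_gen_comp v j : (fox_gen v *m comp_mx) 0 j =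
  weight v *+ (V1 v && (fingraph.root E1 v == enum_val j)).
Proof. by rewrite -rowE !mxE enum_rankK. Qed.

Lemma root_mxK : root_mx *m comp_mx = 1%:M.
Proof.
apply/row_matrixP => j; rewrite row_mul rowK -scalemxAl; apply/rowP => j'.
rewrite mxE fox_gen_comp !mxE.
have /andP[/eqP rj V1j] : enum_val j \in A by exact: enum_valP.
rewrite rj [V1 _]V1j (inj_eq enum_val_inj) /=; case: eqP => _.
  by rewrite mulVf ?weight_neq0.
by rewrite mulr0.
Qed.

(** Two resonant ends make both coefficients vanish. With exactly one, that end is deleted, so its
    row of [comp_mx] is zero, and the coefficient of the other end vanishes. On [E_R] the factor
    [cyclo_sum] is zero. A surviving edge stays in one component, where the weights balance. *)
Lemma artin_comp v w : adj v w ->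
  (fox (artin_rel v w (lt v w)) - fox (artin_rel w v (lt v w))) *m comp_mx = 0.
Proof.
move=> vw; rewrite fox_artin_rel -scalemxAl mulmxBl -!scalemxAl.
have [] := (fox_gen_comp v, fox_gen_comp w).
move: (fox_gen v *m _) (fox_gen w *m _) => rv rw rvE rwE.
have VRV1 a b : adj a b -> VR m a -> ~~ VR m b -> V1 a = false.
  move=> ab VRa nVRb; apply/negbF; rewrite VRa; apply/existsP; exists b.
  by rewrite ab nVRb.
have nVRV1 a : ~~ VR m a -> V1 a by rewrite /Defs.V1 => /negPf ->.
have VR0 a : VR m a -> 1 - t ^ gdeg a = 0 by rewrite -sub1_expz_eq0 => /eqP.
apply/rowP => j; rewrite !mxE rvE rwE.
have [VRv|nVRv] := boolP (VR m v); have [VRw|nVRw] := boolP (VR m w).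
- by rewrite !VR0 // !mul0r subrr mulr0.
- by rewrite (VRV1 v w) // (VR0 v) //= mul0r mulr0 subrr mulr0.
- by rewrite (VRV1 w v) 1?adj_sym // (VR0 w) //= mul0r mulr0 subrr mulr0.
rewrite !nVRV1 //=; have [/andP[/eqP mvw /eqP lK]|nER] := boolP (ER lt m K v w).
  by rewrite cyclo_sum_eq0 ?mul0r.
have /(connect1)/(fingraph.rootP E1_csym) -> : E1 v w.
  by rewrite /Defs.E1 vw !nVRV1 // (negPf nVRv) nER.
rewrite /weight (negPf nVRv) (negPf nVRw) !mulrnAr [(1 - _ ^ gdeg w) * _]mulrC.
by rewrite subrr mulr0.
Qed.

(** On an edge of [Gamma_1] the factor [cyclo_sum] and both weights are nonzero, so the edge
    relation can be divided by them. *)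
Lemma fcoord_edge v w : E1 v w ->
  fcoord x 0 ((weight v)^-1 *: fox_gen v - (weight w)^-1 *: fox_gen w).
Proof.
move=> Evw; have /and5P[vw _ _ _ nER] := Evw.
have nVRv := E1_nonresonant Evw.
have nVRw : ~~ VR m w by apply: (@E1_nonresonant w v); rewrite E1_sym.
have := fcoord_artin lt K chi_g_dvd chi_g_neq0 vw; rewrite fox_artin_rel.
have weightE u : ~~ VR m u -> 1 - t ^ gdeg u = weight u.
  by rewrite /weight => /negPf ->.
rewrite !weightE //.
have c0 : cyclo_sum v w (lt v w) != 0.
  by apply: cyclo_sum_neq0 => //; apply: lt_gt0.
move/(fcoord0Z ((weight v * weight w)^-1 * (cyclo_sum v w (lt v w))^-1)).
rewrite scalerA mulfVK // scalerBr !scalerA.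
by rewrite mulfVMr ?weight_neq0 // mulfVMl ?weight_neq0.
Qed.

Lemma fcoord_connect v w : connect E1 v w ->
  fcoord x 0 ((weight v)^-1 *: fox_gen v - (weight w)^-1 *: fox_gen w).
Proof.
move=> /connectP[p]; elim: p v => [|u p IH] v /=.
  by move=> _ ->; rewrite subrr; apply: fcoord0.
move=> /andP[/fcoord_edge vu /IH{}IH] /IH{}IH.
by have := fcoordD vu IH; rewrite addr0 addrA subrK.
Qed.

(** Modulo relations, a vertex of [Gamma_1] is a multiple of the root of its component, and a
    deleted vertex is zero. *)
Lemma fcoord_gen_root i : fcoord x 0 (row i (1%:M - comp_mx *m root_mx)).
Proof.
rewrite linearB /= row1 row_mul mulmx_sum_row.
under eq_bigr => j _ do rewrite rowK 2!mxE.
set v := enum_val i; have -> : delta_mx 0 i = fox_gen v.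
  by rewrite /fox_gen enum_valK.
have [V1v|nV1v] := boolP (V1 v); last first.
  rewrite big1 ?subr0; last by move=> j _; rewrite scale0r.
  (* A deleted vertex is resonant with a nonresonant neighbour [w]; the relation of this edge is a
     nonzero multiple of [fox_gen v] alone. *)
  move: nV1v; rewrite /Defs.V1 negbK => /andP[VRv /existsP[w /andP[vw nVRw]]].
  have := fcoord_artin lt K chi_g_dvd chi_g_neq0 vw; rewrite fox_artin_rel.
  have /eqP v0 : 1 - t ^ gdeg v == 0 by rewrite sub1_expz_eq0.
  rewrite v0 scale0r subr0 scalerA; set c := _ * _ => /(fcoord0Z c^-1).
  have c0 : c != 0.
    rewrite mulf_neq0 ?sub1_expz_eq0 //; apply: cyclo_sum_neq0 => //.
      exact: lt_gt0.
    by rewrite (eqP VRv) add0r [m w == 0](negPf nVRw).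
  by rewrite scalerA mulVf // scale1r.
have rA := root_in_comp V1v.
rewrite (bigD1 (enum_rank_in rA (fingraph.root E1 v))) //= enum_rankK_in // eqxx.
rewrite big1 ?addr0.
  have := fcoord0Z (weight v) (fcoord_connect (connect_root E1 v)).
  by rewrite scalerBr !scalerA divff ?weight_neq0 // scale1r.
move=> j jr; case: eqP => [vj|]; last by rewrite scale0r.
by case/eqP: jr; apply: enum_val_inj; rewrite enum_rankK_in.
Qed.

(** Such a [q] is fixed by [1%:M - comp_mx *m root_mx], whose rows are relations. *)
Lemma fcoord_comp_ker q : q *m comp_mx = 0 -> fcoord x 0 q.
Proof.
move=> qB0; have -> : q = q *m (1%:M - comp_mx *m root_mx).
  by rewrite mulmxBr mulmx1 mulmxA qB0 mul0mx subr0.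
rewrite mulmx_sum_row; apply: fcoord0_sum => i.
exact/fcoord0Z/fcoord_gen_root.
Qed.

Lemma fox_g_comp_neq0 : fox g *m comp_mx != 0.
Proof.
(* The columns of the nonresonant components add up to the vector of all [1 - t ^ gdeg v]. By the
   fundamental formula it pairs with [fox g] to [1 - t], since [g] has degree one. *)
pose nr : 'cV[F]_#|A| := \col_j (~~ VR m (enum_val j))%:R.
have : 1 - t != 0.
  by rewrite subr_eq0 eq_sym -[t]expr1z tofracX_expz_eq1.
apply: contraNneq => gB0; rewrite -[t]expr1z -(deg_g chi_g_dvd chi_g_neq0).
rewrite -fox_fundamental (_ : \sum_v _ = (fox g *m comp_mx *m nr) 0 0).
  by rewrite gB0 mul0mx mxE.
have -> : fox g *m comp_mx *m nr = fox g *m (\col_i (1 - t ^ gdeg (enum_val i))).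
  rewrite -mulmxA; congr (_ *m _); apply/colP => i; rewrite !mxE.
  set v := enum_val i.
  under eq_bigr => j _ do rewrite !mxE -/v.
  have [VRv|nVRv] := boolP (VR m v).
    have /eqP -> : 1 - t ^ gdeg v == 0 by rewrite sub1_expz_eq0.
    apply: big1 => j _; case: (eqVneq (fingraph.root E1 v) (enum_val j)) => [<-|].
      by rewrite -(connect_VR (connect_root _ _)) VRv mulr0.
    by rewrite andbF mul0r.
  have V1v : V1 v by rewrite /Defs.V1 (negPf nVRv).
  have rA := root_in_comp V1v.
  rewrite (bigD1 (enum_rank_in rA (fingraph.root E1 v))) //= enum_rankK_in // eqxx V1v.
  rewrite -(connect_VR (connect_root _ _)) nVRv mulr1 big1 ?addr0.
    by rewrite /weight (negPf nVRv).
  move=> j jr; case: eqP => [vj|]; last by rewrite mul0r.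
  by case/eqP: jr; apply: enum_val_inj; rewrite enum_rankK_in.
rewrite mxE (reindex _ (onW_bij _ (enum_rank_bij V))).
by apply: eq_bigr => v _; rewrite mxE enum_rankK.
Qed.

(** Its columns span those solutions of the edge relations that [fox g] also kills. *)
Definition sol_mx : 'M[F]_(#|V|, #|A|) := comp_mx *m cokermx (fox g *m comp_mx).

Lemma rank_sol_mx : \rank sol_mx = (ncomp_Gamma1 adj lt m K - 1)%N.
Proof.
(* Left multiplication by the left-invertible [comp_mx] preserves rank, and the cokernel of a
   nonzero row has corank one. *)
have full : row_full comp_mx by apply/row_fullP; exists root_mx; apply: root_mxK.
by rewrite (eqmxMfull _ full) mxrank_coker rank_rV fox_g_comp_neq0.
Qed.

Lemma fox_g_sol : fox g *m sol_mx = 0.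
Proof. by rewrite mulmxA mulmx_coker. Qed.

(** The hypothesis puts [q *m comp_mx] on the line of [fox g *m comp_mx]; subtracting a multiple of
    the relation [fox g] leads back to [fcoord_comp_ker]. *)
Lemma fcoord_sol_ker q : q *m sol_mx = 0 -> fcoord x 0 q.
Proof.
move=> /eqP; rewrite mulmxA -submxE => /sub_rVP[a qB].
have /fcoord_comp_ker Hq : (q - a *: fox g) *m comp_mx = 0.
  by rewrite mulmxBl -scalemxAl -qB subrr.
have := fcoordD Hq (fcoord0Z a (fcoord_fox_g adj lt K chi_g_dvd chi_g_neq0)).
by rewrite addr0 subrK.
Qed.

End Rank.

(** * Upper and lower bounds for the rank *)

Section Independence.
Variables (V : finType) (adj : rel V) (lt : V -> V -> nat) (m : V -> int).
Variables (K : fieldType) (g : word V).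
Hypothesis chi_g_dvd : forall w : word V, (chi m g %| chi m w)%Z.
Hypothesis chi_g_neq0 : chi m g != 0.
Hypothesis adj_sym : symmetric adj.
Hypothesis lt_sym : forall v w, adj v w -> lt v w = lt w v.
Hypothesis lt_gt0 : forall v w, adj v w -> (0 < lt v w)%N.
Local Notation F := {fraction {poly K}}.
Local Notation t := ('X : {poly K})%:F.
Local Notation hz := (@h1zero V adj lt m K).
Local Notation cl := (@cl V adj lt m K g).
Local Notation gdeg := (gdeg m g).
Local Notation deg := (chi gdeg).
Local Notation fox := (@fox V m K g).
Local Notation foxc := (@foxc V m K g).
Local Notation x := (xgen adj lt m K g).
Local Notation Z := (sol_mx adj lt m K g).
Local Notation r := (ncomp_Gamma1 adj lt m K - 1)%N.

Lemma cl_flatten (cs : seq (chain V K)) : cl (flatten cs) = \sum_(c <- cs) cl c.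
Proof.
by rewrite cl_ext ext_flatten; apply: eq_bigr => c _; rewrite -cl_ext.
Qed.

(** The upper bound: a linear dependence over [F] is cleared of denominators and then of torsion. *)
Lemma h1_dependent (cs : seq (chain V K)) :
  all (@is_chain V m K) cs -> (r < size cs)%N ->
  exists ls : seq (laurent K), [/\ size ls = size cs,
    hz (flatten [seq lact g lc.1 lc.2 | lc <- zip ls cs])
    & ~~ all (fun l => l.2 == 0) ls].
Proof.
move=> cs_chain r_lt; set n := size cs; pose C (i : 'I_n) := nth [::] cs i.
have csE : cs = [seq C i | i <- enum 'I_n].
  by rewrite (map_comp (nth [::] cs) val) val_enum_ord map_nth_iota0 // take_size.
have C_chain i : is_chain m (C i) by apply: (allP cs_chain); apply: mem_nth.
pose X := \matrix_(i < n) foxc (C i).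
(* There are more rows than the rank of [Z]. *)
have [a aXZ a0] : exists2 a : 'rV_n, a *m (X *m Z) = 0 & a != 0.
  have : kermx (X *m Z) != 0.
    rewrite kermx_eq0 -row_leq_rank -ltnNge.
    by apply: leq_ltn_trans (mxrankM_maxr _ _) _; rewrite rank_sol_mx.
  by case/rowV0Pn => a /sub_kermxP aXZ a0; exists a.
have [d [b [d0 db]]] := fraction_clear_fin (fun i => a 0 i).
pose q : 'rV[F]_#|V| := \sum_i (b i)%:F *: foxc (C i).
have qE : q = d%:F *: (a *m X).
  rewrite mulmx_sum_row scaler_sumr; apply: eq_bigr => i _.
  by rewrite rowK scalerA db.
have Hq : fcoord x 0 q.
  by apply: fcoord_sol_ker => //; rewrite qE -scalemxAl -mulmxA aXZ scaler0.
have Hy : fcoord x (\sum_i b i *: cl (C i)) q.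
  rewrite /q; elim/big_ind2: _ => [||i _].
  - exact: fcoord0.
  - by move=> y1 q1 y2 q2; apply: fcoordD.
  - exact/fcoordZ/fcoord_foxc.
(* Both the combination and zero have coordinates [q], so the combination is torsion; its
   annihilator [p] enters the final coefficients. *)
have := fcoordD Hy (fcoordN Hq); rewrite subrr oppr0 addr0.
case/fcoord_torsion => p p0 Hp.
exists [seq (0%N, p * b i) | i <- enum 'I_n]; split.
- by rewrite size_map size_enum_ord.
- rewrite csE zip_map -map_comp; apply/(@h1zeroP _ _ _ _ _ g); rewrite -[0]Hp.
  rewrite cl_flatten big_map big_enum /= scaler_sumr; apply: eq_bigr => i _.
  by rewrite scalerA cl_lact0.
- rewrite all_map; apply: contraNN a0 => /allP H.
  apply/eqP/rowP => i; rewrite mxE; have := H i; rewrite mem_enum => /(_ isT) /=.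
  rewrite mulf_eq0 (negPf p0) /= => /eqP bi.
  have /eqP := db i; rewrite bi tofrac0 mulf_eq0 tofrac_eq0 (negPf d0).
  by move/eqP.
Qed.

(** An invariant of group elements, additive on the kernel, so that its linear extension vanishes on
    null chains and can certify independence. *)
Definition psi (u : word V) := fox u *m Z.

Lemma psi_aeq u w : aeq adj lt u w -> psi u = psi w.
Proof.
rewrite /psi; elim=> {u w} [//|//|u w y _ -> _ -> //|a b u w uw IH|v b|v w vw].
- by rewrite !fox_cat !mulmxDl -!scalemxAl !mulmxDl IH -!scalemxAl (aeq_deg _ _ uw).
- by rewrite fox_free.
- apply/eqP; rewrite -subr_eq0 -mulmxBl mulmxA artin_comp //.
  by rewrite mul0mx.
Qed.

Lemma psi_h1zero c : hz c -> ext (tofracC K) psi c = 0.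
Proof.
move=> [s [sr /(ext_coef (tofracC K) psi) ->]].
elim: sr => [|a u w u0 w0|a u w u0 uw|c1 c2 _ IH1 _ IH2].
- by rewrite /ext big_nil.
- rewrite /ext !big_cons big_nil addr0 /= /psi fox_cat.
  have /eqP -> : deg u == 0 by rewrite deg_eq0 // u0.
  by rewrite expr0z scale1r mulmxDl polyCN tofracN scaleNr scalerDr addrA subrr.
- rewrite /ext !big_cons big_nil addr0 /= (psi_aeq uw).
  by rewrite polyCN tofracN scaleNr subrr.
- by rewrite ext_cat IH1 IH2 addr0.
Qed.

Lemma tofrac_poly (p : {poly K}) :
  p%:F = \sum_(i < size p) (p`_i)%:P%:F * t ^+ i.
Proof.
rewrite -[in LHS](coefK p) poly_def rmorph_sum; apply: eq_bigr => i _ /=.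
by rewrite -mul_polyC tofracM tofracXn.
Qed.

Lemma psi_lact n p u : chi m u = 0 ->
  ext (tofracC K) psi (lact g (n, p) [:: (1, u)]) = (p%:F * t ^ (- n%:Z)) *: psi u.
Proof.
move=> u0; rewrite ext_lact tofrac_poly mulr_suml scaler_suml.
have du : deg u = 0 by apply/eqP; rewrite deg_eq0 // u0.
apply: eq_bigr => i _; rewrite /ext big_seq1 /= tofrac1 scale1r /psi.
rewrite fox_conj; last by rewrite !chi_cat chi_winv addrC subrK.
rewrite fox_conj // !deg_wpow chi_winv deg_g // mulNrn !natz -!scalemxAl !scalerA.
by rewrite mulrA.
Qed.

Lemma psi_bra v : psi (bra m g [:: (v, false)]) = row (enum_rank v) Z.
Proof.
rewrite /psi /bra fox_cat; have [a ->] := fox_gpow m K g (- deg [:: (v, false)]).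
by rewrite mulmxDl -!scalemxAl fox_g_sol !scaler0 addr0 fox_letterE -rowE.
Qed.

(** The lower bound: vertices are chosen whose rows form a basis of the row space of [Z]. A Laurent
    relation among their classes becomes, under [psi], a linear relation among these rows. *)
Lemma h1_independent_exists :
  exists cs : seq (chain V K), h1_independent adj lt m g cs /\ size cs = r.
Proof.
rewrite -(rank_sol_mx K chi_g_dvd chi_g_neq0 adj_sym lt_sym).
pose f := maxrankfun Z.
pose C i : chain V K := [:: (1, bra m g [:: (enum_val (f i), false)])].
exists [seq C i | i <- enum 'I_(\rank Z)]; split; last first.
  by rewrite size_map size_enum_ord.
split; first by rewrite all_map; apply/allP => i _ /=; rewrite chi_bra ?eqxx.
move=> ls; rewrite size_map size_enum_ord => size_ls.
pose l i : laurent K := nth (0%N, 0) ls i.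
have lsE : ls = [seq l (val i) | i <- enum 'I_(\rank Z)].
  rewrite (map_comp l val) val_enum_ord -size_ls.
  by rewrite map_nth_iota0 // take_size.
rewrite lsE zip_map -map_comp => /psi_h1zero.
rewrite ext_flatten big_map big_enum /= => sum0.
pose a : 'rV[F]_(\rank Z) := \row_i ((l i).2%:F * t ^ (- (l i).1%:Z)).
have /eqP : a *m rowsub f Z = 0.
  rewrite mulmx_sum_row -[RHS]sum0; apply: eq_bigr => i _.
  rewrite [l i]surjective_pairing psi_lact ?chi_bra // psi_bra enum_valK mxE.
  by rewrite row_rowsub.
rewrite -[0](mul0mx _ (rowsub f Z)) (inj_eq (row_free_inj (maxrowsub_free Z))).
move=> /eqP a0; rewrite all_map; apply/allP => i _ /=.
have /eqP := congr1 (fun A : 'rV_ _ => A 0 i) a0; rewrite !mxE mulf_eq0 tofrac_eq0.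
by rewrite (negPf (expfz_neq0 _ _)) ?tofracX_neq0 // orbF.
Qed.

End Independence.

Theorem theorem4p1 (V : finType) (adj : rel V) (lt : V -> V -> nat)
    (K : fieldType) (m : V -> int) (g : word V) :
  irreflexive adj -> symmetric adj ->
  (forall v w, adj v w -> lt v w = lt w v) ->
  (forall v w, adj v w -> (0 < lt v w)%N) ->
  (exists v, m v != 0) ->
  (forall w : word V, (chi m g %| chi m w)%Z) ->
  h1_rank_is adj lt m K g (ncomp_Gamma1 adj lt m K - 1) /\
  (h1_torsion adj lt m K g <-> ncomp_Gamma1 adj lt m K = 1%N).
Proof.
move=> _ adj_sym lt_sym lt_gt0 [v0 mv0] chi_g_dvd.
(* Otherwise divisibility would force [chi] to vanish on every generator. *)
have chi_g_neq0 : chi m g != 0.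
  apply: contraNneq mv0 => g0; have := chi_g_dvd [:: (v0, false)].
  by rewrite g0 dvd0z /chi big_seq1.
have dependent := @h1_dependent V adj lt m K g
  chi_g_dvd chi_g_neq0 adj_sym lt_sym lt_gt0.
have exist := h1_independent_exists K chi_g_dvd chi_g_neq0 adj_sym lt_sym.
(* The nonresonant vertex [v0] survives in [Gamma_1], so the natural-number subtraction of 1 is not
   truncated. *)
have ncomp_gt0 : (0 < ncomp_Gamma1 adj lt m K)%N.
  apply/card_gt0P; exists (fingraph.root (E1 adj lt m K) v0).
  by apply: root_in_comp => //; rewrite /V1 /VR (negPf mv0).
split; [split=> // cs [cs_chain indep] | split].
- rewrite leqNgt; apply/negP => /(dependent _ cs_chain)[ls [size_ls ls0]].
  by rewrite indep.
- move=> tors; apply/eqP; rewrite eqn_leq ncomp_gt0 andbT leqNgt.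
  apply/negP => ncomp_gt1; have [cs [[cs_chain indep] size_cs]] := exist.
  case: cs => [|c cs] in cs_chain indep size_cs.
    by move: ncomp_gt1; rewrite -subn_gt0 -size_cs.
  have /andP[c_chain _] := cs_chain; have [l [l0 lc0]] := tors c c_chain.
  (* The annihilator of [c], padded with zeros, is a nontrivial relation in an independent
     family. *)
  have := indep (l :: nseq (size cs) (0%N, 0)).
  rewrite /= size_nseq (negPf l0) => /(_ erefl) H; suff: false by [].
  apply: H; rewrite (_ : flatten _ = [::]) ?cats0 //.
  elim: (cs) => //= c' cs' IH; rewrite IH cats0.
  by rewrite /lact size_poly0.
- move=> ncomp1 c c_chain.
  (* With one component the bound is zero, so a single chain is already dependent. *)
  have [||ls [size_ls ls0 nz]] := dependent [:: c].
  - by rewrite /= c_chain.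
  - by rewrite ncomp1.
  case: ls size_ls ls0 nz => [|l [|]] //= _; rewrite cats0 andbT => lc0 l0.
  by exists l.
Qed.
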